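(* Let each $f_i:\mathcal H\to\mathbb R$ be convex and continuously differentiable, with gradient $\nabla f_i$ Lipschitz with constant $L_i$, where $L_i\le \sup L<\infty$ almost surely for $i\sim\mathcal D$, and let $F(x)=\mathbb E_{i\sim\mathcal D} f_i(x)$ be $\mu$-strongly convex, $\mu>0$. Set $\sigma^2=\mathbb E_{i\sim\mathcal D}\|\nabla f_i(x_\star)\|_2^2$, where $x_\star=\arg\min_x F(x)$. Suppose the step size $\gamma>0$ satisfies $\gamma<\frac{1}{\sup L}$. Then, for every starting point $x_0\in\mathcal H$ and every $k\ge 0$, the stochastic gradient descent iterates $x_{k+1}=x_k-\gamma\nabla f_{i_k}(x_k)$, with $i_0,i_1,\dots$ drawn i.i.d. from $\mathcal D$, satisfy $$\mathbb E\|x_k-x_\star\|_2^2\le\bigl[1-2\gamma\mu(1-\gamma\sup L)\bigr]^k\|x_0-x_\star\|_2^2+\frac{\gamma\sigma^2}{\mu(1-\gamma\sup L)},$$ where the expectation is with respect to the sampling of $\{i_k\}$.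
   Context: $\mathcal H$ is $\mathbb R^d$ with the Euclidean norm $\|\cdot\|_2$, or a Hilbert space with norm $\|\cdot\|_2$. $\mathcal D$ is a probability distribution (the source distribution) on an arbitrary probability space of indices $i$. Lipschitz gradient with constant $L_i$ means $\|\nabla f_i(x)-\nabla f_i(y)\|_2\le L_i\|x-y\|_2$ for all $x,y$. $F$ is $\mu$-strongly convex means $\langle x-y,\nabla F(x)-\nabla F(y)\rangle\ge\mu\|x-y\|_2^2$ for all $x,y$. $\sup L$ denotes the smallest $L$ such that $L_i\le L$ almost surely. The gradient estimates are unbiased: $\mathbb E_{i\sim\mathcal D}\nabla f_i(x)=\nabla F(x)$ for all $x$. *)

(* Defs.v *)
From HB Require Import structures.
From mathcomp Require Import all_boot all_order all_algebra finmap.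
From mathcomp Require Import all_classical all_reals all_analysis ess_sup_inf.

Set Implicit Arguments.
Unset Strict Implicit.
Unset Printing Implicit Defensive.

Import Order.TTheory GRing.Theory Num.Theory.
Import numFieldNormedType.Exports.

Local Open Scope classical_set_scope.
Local Open Scope ring_scope.

(* A real Hilbert space is a [completeNormedModType] together with a dot
   product inducing its norm. [R^d] with the Euclidean norm is the
   finite-dimensional case; it is not ['rV[R]_d], which carries the sup norm. *)
Definition induces_norm (R : realType) (H : completeNormedModType R)
    (dot : {dot H for @idfun R}) : Prop :=
  forall x : H, `|x| = Num.sqrt (dot x x).

Definition is_gradient (R : realType) (H : completeNormedModType R)
    (dot : {dot H for @idfun R}) (f : H -> R) (gradf : H -> H) : Prop :=
  forall x : H, differentiable f x /\ forall v : H, 'd f x v = dot (gradf x) v.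

Definition gradient_lipschitz (R : realType) (H : completeNormedModType R)
    (gradf : H -> H) (L : R) : Prop :=
  forall x y : H, `|gradf x - gradf y| <= L * `|x - y|.

Definition gradient_strongly_convex (R : realType)
    (H : completeNormedModType R) (dot : {dot H for @idfun R})
    (gradF : H -> H) (mu : R) : Prop :=
  forall x y : H, mu * `|x - y| ^+ 2 <= dot (x - y) (gradF x - gradF y).

Section bochner.
Context (d : measure_display) (T : measurableType d) (R : realType).
Context (H : completeNormedModType R) (P : probability T R).

Definition simple_vector (s : T -> H) : Prop :=
  finite_set (range s) /\ forall y : H, measurable (s @^-1` [set y]).

Definition simple_mean (s : T -> H) : H :=
  \sum_(y \in range s) fine (P (s @^-1` [set y])) *: y.

(* [X] is Bochner integrable (in particular strongly measurable) with Bochner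
   integral [m]. In finite dimension this is the coordinatewise expectation. *)
Definition bochner_mean (X : T -> H) (m : H) : Prop :=
  exists s_ : nat -> T -> H,
    [/\ forall n, simple_vector (s_ n),
        {ae P, forall t, s_ n t @[n --> \oo] --> X t},
        ('E_P[fun t => `|X t - s_ n t|%R])%E @[n --> \oo] --> 0%E
      & simple_mean (s_ n) @[n --> \oo] --> m].

End bochner.

Definition mutually_independent (d d' : measure_display)
    (Omega : measurableType d) (I : measurableType d') (R : realType)
    (P : probability Omega R) (X : nat -> {RV P >-> I}) : Prop :=
  forall (J : {fset nat}) (A : nat -> set I),
    (forall j, j \in J -> measurable (A j)) ->
    P (\bigcap_(j in [set` J]) (X j @^-1` A j)) =
      (\prod_(j <- J) P (X j @^-1` A j))%E.

Definition iid (d d' : measure_display)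
    (Omega : measurableType d) (I : measurableType d') (R : realType)
    (P : probability Omega R) (D : probability I R)
    (X : nat -> {RV P >-> I}) : Prop :=
  (forall (k : nat) (A : set I),
     measurable A -> distribution P (X k) A = D A) /\
  mutually_independent X.

Fixpoint sgd (I : Type) (R : realType) (H : completeNormedModType R)
    (gradf : I -> H -> H) (gamma : R) (x0 : H) (i_ : nat -> I) (k : nat) : H :=
  if k is j.+1 then
    let x := sgd gradf gamma x0 i_ j in x - gamma *: gradf (i_ j) x
  else x0.

(* Main.v *)
Require Import Defs.
From HB Require Import structures.
From mathcomp Require Import all_boot all_order all_algebra finmap.
From mathcomp Require Import all_classical all_reals all_analysis ess_sup_inf.
From mathcomp Require Import measurable_realfun.
From mathcomp Require Import ring lra.

(** Expand the squared distance after one step. For a convex [f i] whose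
    gradient is Lipschitz with constant [supL], cocoercivity of the gradient
    ([gradient_cocoercive]) bounds [|gradf i x - gradf i xstar| ^ 2] by [supL]
    times an inner product, so the square of the step is paid for by its
    linear term ([gradient_step_sqdist_le]). In the mean over [i] the inner
    products are those of [gradF] ([gradient_mean]), where strong convexity
    and [gradF xstar = 0] give
<<
      E |x_(k+1) - xstar|^2 <= q E |x_k - xstar|^2 + 2 gamma^2 sigma^2
>>
    with [q = 1 - 2 gamma mu (1 - gamma supL)]. Unrolling this recursion,
    whose fixed point is [gamma sigma^2 / (mu (1 - gamma supL))], is the
    theorem.

    The remaining difficulty is to take the mean over [i_ k] while [x_k] is
    itself random. The estimates are strongly measurable at each point of [H],
    with a null set depending on the point; [H] may be nonseparable and
    carries no sigma-algebra, so Fubini does not apply to [(i, x)]. The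
    iterates are therefore approximated, uniformly up to a null set, by maps
    with countably many values ([countably_valued_approximation]), and these
    values are indexed by labels in [nat] whose level sets are independent of
    the draws still to come ([independent_of_tail], [next_label_tail]). On
    each level set the next draw is integrated out with the current point
    fixed ([integral_next_label]), and only countably many null sets are
    involved ([sgd_approximation]). A step with [gamma supL < 1] is Lipschitz,
    so the error of the approximation stays under control, and it is sent to
    zero at the end ([sgd_sqdist_le]). The expectation in the conclusion is
    that of a function which need not be measurable; as a supremum over simple
    functions it is still monotone ([ge0_ae_le_integral_nonmeasurable]). *)

Import Order.TTheory GRing.Theory Num.Theory.
Import numFieldNormedType.Exports.

Local Open Scope classical_set_scope.
Local Open Scope ring_scope.

Set Implicit Arguments.
Unset Strict Implicit.

(** * Inner products, convexity and gradient steps *)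

Section hilbert.
Context (R : realType) (H : completeNormedModType R).
Context (dot : {dot H for @idfun R}).
Hypothesis Hdot : induces_norm dot.
Implicit Types (x y z u v w : H) (a : R).

Lemma dotC x y : dot x y = dot y x.
Proof. by rewrite hermC /= expr0 mul1r. Qed.

Let dotDl x y z : dot (x + y) z = dot x z + dot y z.
Proof. by rewrite linearDl. Qed.

Let dotBl x y z : dot (x - y) z = dot x z - dot y z.
Proof. by rewrite linearBl. Qed.

Let dotZl a x z : dot (a *: x) z = a * dot x z.
Proof. by rewrite linearZl_LR. Qed.

Let dotDr x y z : dot z (x + y) = dot z x + dot z y.
Proof. by rewrite dotC dotDl !(dotC z). Qed.

Let dotBr x y z : dot z (x - y) = dot z x - dot z y.
Proof. by rewrite dotC dotBl !(dotC z). Qed.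

Let dotNr x z : dot z (- x) = - dot z x.
Proof. by rewrite linearNr. Qed.

Let dotZr a x z : dot z (a *: x) = a * dot z x.
Proof. by rewrite dotC dotZl (dotC z). Qed.

Lemma dot_self x : dot x x = `|x| ^+ 2.
Proof.
rewrite Hdot sqr_sqrtr//; have [->|x0] := eqVneq x 0; first by rewrite linear0l.
exact/ltW/neq0_dnorm_gt0.
Qed.

Lemma normDsqr x y : `|x + y| ^+ 2 = `|x| ^+ 2 + 2 * dot x y + `|y| ^+ 2.
Proof. by rewrite -!dot_self dotDl !dotDr (dotC y x); ring. Qed.

Lemma normBsqr x y : `|x - y| ^+ 2 = `|x| ^+ 2 - 2 * dot x y + `|y| ^+ 2.
Proof. by rewrite -!dot_self dotBl !dotBr (dotC y x); ring. Qed.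

(** Cauchy-Schwarz, from the nonnegative square of [|y| x - |x| y]. *)
Lemma dot_le x y : dot x y <= `|x| * `|y|.
Proof.
have [->|y0] := eqVneq y 0; first by rewrite linear0r normr0 mulr0.
have [->|x0] := eqVneq x 0; first by rewrite linear0l normr0 mul0r.
have := sqr_ge0 (`| `|y| *: x - `|x| *: y|).
rewrite normBsqr dotZl dotZr !normrZ !normr_id => h.
have xy0 : 0 < `|x| * `|y| by rewrite mulr_gt0// normr_gt0.
rewrite -(ler_pM2l xy0); nra.
Qed.

Lemma normDsqr_le x y : `|x + y| ^+ 2 <= 2 * `|x| ^+ 2 + 2 * `|y| ^+ 2.
Proof. by have := sqr_ge0 `|x - y|; rewrite normDsqr normBsqr => ?; lra. Qed.

Lemma is_gradient_line f g : is_gradient dot f g -> forall x v (t : R),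
  is_derive t 1 (fun s : R => f (x + s *: v)) (dot (g (x + t *: v)) v).
Proof.
move=> fg x v t.
have [df dfE] := fg (x + t *: v).
have E : (fun h : R => h^-1 *: (f (x + (h *: 1 + t) *: v) - f (x + t *: v))) =
  (fun h : R => h^-1 *: (f (h *: v + (x + t *: v)) - f (x + t *: v))).
  by apply/funext => h; rewrite [h *: 1]mulr1 scalerDl addrCA.
apply: DeriveDef; first by rewrite /derivable/= E; exact: diff_derivable.
by rewrite /derive/= E -dfE -deriveE.
Qed.

(** Only the difference quotients along [1 / n] matter below: convexity and the
    optimality condition are pointwise inequalities on them, and a sequence is
    what measurability and dominated convergence require. *)
Lemma gradient_quotient_cvg f g x v : is_gradient dot f g ->
  n.+1%:R * (f (x + n.+1%:R^-1 *: v) - f x) @[n --> \oo] --> dot (g x) v.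
Proof.
move=> fg.
have [df dfE] := fg x.
have : h^-1 *: (f (h *: v + x) - f x) @[h --> 0^'] --> dot (g x) v.
  by rewrite -dfE -deriveE//; exact: diff_derivable.
move=> /cvgr_dnbhsP/(_ (fun n => n.+1%:R^-1)).
have -> : (fun n : nat => n.+1%:R * (f (x + n.+1%:R^-1 *: v) - f x)) =
    (fun n : nat => n.+1%:R^-1^-1 *: (f (n.+1%:R^-1 *: v + x) - f x)).
  by apply/funext => n; rewrite invrK (addrC x).
by apply; split; [move=> n; rewrite invr_eq0 pnatr_eq0|exact: cvg_harmonic].
Qed.

Lemma convex_gradient_le (f : H -> R) g :
  convex_function [set: convex_lmodType H] f -> is_gradient dot f g ->
  forall x v, f x + dot (g x) v <= f (x + v).
Proof.
move=> cf fg x v.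
rewrite -lerBrDl.
have h0 := @gradient_quotient_cvg f g x v fg; apply: (cvgr_to_le h0).
apply: nearW => n; pose t : R := n.+1%:R^-1.
have t0 : 0 <= t by rewrite invr_ge0.
have t1 : t <= 1 by rewrite invf_le1// ler1n.
have := cf (Itv01 t0 t1) (x + v) x (mem_set I) (mem_set I).
rewrite /conv/=/conv/= /unstable.onem.
have -> : t *: (x + v) + (1 - t) *: x = x + t *: v.
  by rewrite scalerDr scalerBl scale1r addrC addrA subrK.
move=> h.
have : f (x + t *: v) - f x <= t * (f (x + v) - f x).
  by move: h; rewrite /GRing.scale/= => h; nra.
by rewrite -(ler_pM2l (ltr0Sn R n)) mulrA divff ?pnatr_eq0// mul1r.
Qed.

(** The mean value theorem for [f] along the segment, corrected by the affine
    part and by the quadratic [t ^ 2 L / 2 |v| ^ 2]: by the Lipschitz bound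
    and Cauchy-Schwarz the corrected function has a nonpositive derivative. *)
Lemma gradient_descent_le f g L : is_gradient dot f g ->
  gradient_lipschitz g L ->
  forall x v, f (x + v) <= f x + dot (g x) v + L / 2 * `|v| ^+ 2.
Proof.
move=> fg gL x v.
pose psi (t : R) :=
  f (x + t *: v) - t * dot (g x) v - t ^+ 2 * (L / 2 * `|v| ^+ 2).
pose dpsi (t : R) := dot (g (x + t *: v)) v - dot (g x) v - t * (L * `|v| ^+ 2).
have dpsiE (t : R) : is_derive t 1 psi (dpsi t).
  have := is_gradient_line fg x v t => ?.
  by apply: is_derive_eq; rewrite /dpsi /GRing.scale/=; field.
have psic : {within `[0, 1], continuous psi}.
  by apply: derivable_within_continuous => t _; have [] := dpsiE t.
have [c /[!in_itv]/= /andP[c0 _]] := MVT ltr01 (fun t _ => dpsiE t) psic.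
rewrite subr0 mulr1 /psi scale1r scale0r addr0 expr1n expr0n/= => psiE.
suff dpsi_le0 : dpsi c <= 0 by move: dpsi_le0; rewrite -psiE; lra.
rewrite /dpsi -dotBl subr_le0 (le_trans (dot_le _ _))//.
have := gL (x + c *: v) x; rewrite addrAC subrr add0r normrZ gtr0_norm// => h.
apply: le_trans (ler_wpM2r (normr_ge0 v) h) _.
by rewrite le_eqVlt; apply/orP; left; apply/eqP; ring.
Qed.

(** At [x - t w], with [w = g x - g y], the tangent of [f] at [y] lies below [f]
    and the parabola at [x] lies above it. Comparing the two, and adding the
    inequality with [x] and [y] exchanged, eliminates the values of [f];
    [t = 1 / L] is the best choice. *)
Lemma gradient_cocoercive (f : H -> R) g L :
  convex_function [set: convex_lmodType H] f -> is_gradient dot f g ->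
  gradient_lipschitz g L ->
  forall x y, `|g x - g y| ^+ 2 <= L * dot (x - y) (g x - g y).
Proof.
move=> cf fg gL x y; set w := g x - g y.
have key x' y' t : let w' := g x' - g y' in
    (t - L / 2 * t ^+ 2) * `|w'| ^+ 2 <= f x' - f y' - dot (g y') (x' - y').
  move=> w'.
  have h1 := convex_gradient_le cf fg y' (x' - t *: w' - y').
  have h2 := gradient_descent_le fg gL x' (- (t *: w')).
  rewrite subrKC in h1.
  have := le_trans h1 h2.
  rewrite normrN normrZ exprMn real_normK ?num_real//.
  have -> : x' - t *: w' - y' = (x' - y') - t *: w' by rewrite addrAC.
  have : `|w'| ^+ 2 = dot (g x') w' - dot (g y') w' by rewrite -dotBl dot_self.
  by rewrite dotBr dotNr !dotZr => h3 h4; nra.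
have {}key t : 2 * (t - L / 2 * t ^+ 2) * `|w| ^+ 2 <= dot (x - y) w.
  have h1 := key x y t; have h2 := key y x t.
  have wN : g y - g x = - w by rewrite opprB.
  rewrite /= -/w in h1; rewrite /= wN normrN in h2.
  rewrite -(opprB x y) dotNr in h2.
  have : dot (x - y) w = dot (g x) (x - y) - dot (g y) (x - y).
    by rewrite dotC /w dotBl.
  by move=> ->; lra.
(* L <= 0 forces a constant gradient, and 1 / L is then no step *)
have [L0|L0] := leP L 0.
  have -> : w = 0.
    apply/eqP; rewrite -normr_le0; apply: le_trans (gL x y) _.
    exact: mulr_le0_ge0.
  by rewrite normr0 expr0n/= linear0r mulr0.
have := key L^-1; rewrite -(ler_pM2l L0); apply: le_trans.
rewrite le_eqVlt; apply/orP; left; apply/eqP; field; exact: lt0r_neq0.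
Qed.

(** The difference quotients at a minimum are nonnegative in every direction,
    in particular in the direction opposite to the gradient. *)
Lemma gradient_at_min_eq0 f g xs : is_gradient dot f g ->
  (forall x, f xs <= f x) -> g xs = 0.
Proof.
move=> fg fmin.
suff : dot (g xs) (g xs) <= 0.
  rewrite dot_self => h; apply/eqP.
  by rewrite -normr_eq0 -sqrf_eq0 eq_le h sqr_ge0.
have : 0 <= dot (g xs) (- g xs).
  have h0 := @gradient_quotient_cvg f g xs (- g xs) fg; apply: (cvgr_to_ge h0).
  by apply: nearW => n; rewrite mulr_ge0// subr_ge0.
by rewrite dotNr oppr_ge0.
Qed.
Section gradient_step.
Context (f : H -> R) (g : H -> H) (L gamma : R).
Hypothesis g_lip : gradient_lipschitz g L.
Hypothesis gamma_gt0 : 0 < gamma.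

(** Expand the square. Writing [g x] as [(g x - g z) + g z], the quadratic term
    costs twice the two squared norms, and cocoercivity turns the first of them
    into an inner product, which is what will be integrable against a gradient
    that is only known in mean. *)
Lemma gradient_step_sqdist_le x z :
  convex_function [set: convex_lmodType H] f -> is_gradient dot f g ->
  `|x - gamma *: g x - z| ^+ 2 <=
  `|x - z| ^+ 2
  - 2 * gamma * (1 - gamma * L) * dot (g x) (x - z)
  - 2 * gamma ^+ 2 * L * dot (g z) (x - z)
  + 2 * gamma ^+ 2 * `|g z| ^+ 2.
Proof.
move=> f_convex f_grad; set u := x - z.
have -> : x - gamma *: g x - z = u - gamma *: g x by rewrite addrAC.
rewrite normBsqr dotZr normrZ exprMn (gtr0_norm gamma_gt0).
have := gradient_cocoercive f_convex f_grad g_lip x z.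
have := normDsqr_le (g x - g z) (g z).
rewrite subrK -/u (dotC u) dotBl (dotC u).
set Gxz := `|g x - _| ^+ 2; set Gx := `|g x| ^+ 2; set Gz := `|g z| ^+ 2.
set a := dot (g x) u; set b := dot (g z) u => h1 h2.
have : gamma ^+ 2 * Gx <= gamma ^+ 2 * (2 * (L * (a - b)) + 2 * Gz).
  by rewrite ler_pM2l ?exprn_gt0//; lra.
by lra.
Qed.

Lemma gradient_step_lipschitz x y : gamma * L < 1 ->
  `|(x - gamma *: g x) - (y - gamma *: g y)| <= 2 * `|x - y|.
Proof.
move=> gammaL.
have -> : (x - gamma *: g x) - (y - gamma *: g y) =
    (x - y) - gamma *: (g x - g y).
  by rewrite scalerBr !opprB addrACA [RHS]addrACA; congr (_ + _); rewrite addrC.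
rewrite (le_trans (ler_normB _ _))// normrZ gtr0_norm//.
have := g_lip x y; have := normr_ge0 (x - y); have := normr_ge0 (g x - g y).
set a := `|_ - _|; set b := `|_ - _| => a0 b0 ab.
have : gamma * a <= gamma * (L * b) by rewrite ler_pM2l.
have : (gamma * L) * b <= 1 * b by rewrite ler_wpM2r// ltW.
by lra.
Qed.
End gradient_step.

End hilbert.

(** * Integration of almost everywhere inequalities and of countable labels *)

Section measure_tools.
Context (d : measure_display) (T : measurableType d) (R : realType).

(** The least index works: its level sets are differences of the [E n]. *)
Lemma measurable_selection (E : nat -> set T) :
  (forall n, measurable (E n)) -> (forall t, exists n, E n t) ->
  exists N : T -> nat,
    (forall n, measurable (N @^-1` [set n])) /\ forall t, E (N t) t.
Proof.
move=> mE Ecover.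
have Eb t : exists n, `[< E n t >].
  by have [n ?] := Ecover t; exists n; exact/asboolP.
pose N t := ex_minn (Eb t).
exists N; split => [n|t]; last by rewrite /N; case: ex_minnP => m /asboolP.
have -> : N @^-1` [set n] = seqDU E n.
  apply/seteqP; split => t /=; rewrite /N /seqDU; case: ex_minnP => m.
    move=> /asboolP Emt mmin <-; split => //.
    rewrite -bigcup_mkord => -[k /= km Ekt].
    by have := mmin k (introT (asboolP _) Ekt); rewrite leqNgt km.
  move=> /asboolP Emt mmin [Ent]; rewrite -bigcup_mkord => nEt; apply/eqP.
  rewrite eqn_leq mmin ?andbT; last exact/asboolP.
  by rewrite leqNgt; apply/negP => mn; apply: nEt; exists m.
exact: seqDU_measurable.
Qed.

Context (mu : {measure set T -> \bar R}).

Import HBNNSimple.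

(** The integral of a nonnegative function is a supremum over the simple
    functions below it, so no measurability is needed to compare two of them;
    the exceptional null set is removed from the simple functions. This is
    what gives access to squared norms of vector-valued maps, which are
    measurable only up to a null set. *)
Lemma ge0_ae_le_integral_nonmeasurable (f g : T -> \bar R) :
  (forall t, 0 <= f t)%E -> (forall t, 0 <= g t)%E ->
  {ae mu, forall t, (f t <= g t)%E} ->
  (\int[mu]_t f t <= \int[mu]_t g t)%E.
Proof.
move=> f0 g0 [N [mN N0 fgN]].
rewrite (ge0_integralTE _ f0) (ge0_integralTE _ g0).
apply: ge_ereal_sup => _ /= [h hf <-].
apply: ereal_sup_ge.
have mNC := measurableC mN.
have hE : sintegral mu h = sintegral mu (proj_nnsfun h mNC).
  have /esym := integral_nnsfun mu measurableT h; rewrite patch_setT => ->.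
  have /esym := integral_nnsfun mu measurableT (proj_nnsfun h mNC).
  rewrite patch_setT => ->.
  apply: ae_eq_integral => //.
  - by apply/measurable_EFinP; exact: measurable_funPT.
  - by apply/measurable_EFinP; exact: measurable_funPT.
  exists N; split => // t /= ht; apply: contrapT => Nt; apply: ht => _.
  by rewrite mindicE mem_set// mulr1.
rewrite hE; exists (sintegral mu (proj_nnsfun h mNC)) => //.
exists (proj_nnsfun h mNC) => // t /=; rewrite mindicE.
have [tN|tN] := boolP (t \in ~` N); last by rewrite mulr0.
rewrite mulr1 (le_trans (hf t))//.
by apply: contrapT => fg; rewrite inE in tN; apply: tN; exact: fgN.
Qed.

Lemma ae_le_integral (f g : T -> \bar R) :
  measurable_fun setT f -> measurable_fun setT g ->
  {ae mu, forall t, (f t <= g t)%E} ->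
  (\int[mu]_t f t <= \int[mu]_t g t)%E.
Proof.
move=> mf mg fg; rewrite integralE [leRHS]integralE.
have fg1 t : (f t <= g t)%E -> {in [set t], forall x, (f x <= g x)%E}.
  by move=> fgt x; rewrite inE => ->.
apply: leeB; apply: ae_ge0_le_integral => //.
- exact: measurable_funepos.
- exact: measurable_funepos.
- by apply: filterS fg => t /fg1 fgt _; apply: (funepos_le fgt); rewrite inE.
- exact: measurable_funeneg.
- exact: measurable_funeneg.
- by apply: filterS fg => t /fg1 fgt _; apply: (funeneg_le fgt); rewrite inE.
Qed.

Section countable_labels.
Context (N : T -> nat).
Hypothesis mN : forall n, measurable (N @^-1` [set n]).

Lemma measurable_label_preimage (A : set nat) : measurable (N @^-1` A).
Proof.
have -> : N @^-1` A = \bigcup_(n in A) (N @^-1` [set n]).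
  by apply/seteqP; split => [t /= At|t [n An /= ->]]//; exists (N t).
exact: bigcup_measurable.
Qed.

Lemma measurable_fun_label (d' : measure_display) (Y : measurableType d')
  (D : set T) (h : nat -> Y) : measurable_fun D (fun t => h (N t)).
Proof.
move=> mD A mA; apply: measurableI => //.
exact: (measurable_label_preimage (h @^-1` A)).
Qed.

Lemma ge0_integral_label (B : set T) (h : nat -> \bar R) : measurable B ->
  (forall n, 0 <= h n)%E ->
  (\int[mu]_(t in B) h (N t) =
   \sum_(n <oo) h n * mu (B `&` N @^-1` [set n]))%E.
Proof.
move=> mB h0.
have mBN n : measurable (B `&` N @^-1` [set n]) by exact: measurableI.
have BE : B = \bigcup_n (B `&` N @^-1` [set n]).
  by apply/seteqP; split => [t Bt|t [n _ []]//]; exists (N t).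
rewrite [in LHS]BE ge0_integral_bigcup//=; last 2 first.
  exact: measurable_fun_label.
  by move=> m n _ _ [t [[_ /= ->] [_ /= ->]]].
apply: eq_eseriesr => n _.
under eq_integral.
  move=> t; rewrite inE/= => -[_ ->]; over.
by rewrite integral_cst.
Qed.

End countable_labels.
End measure_tools.

Lemma probability_integral_cst (d : measure_display) (T : measurableType d)
  (R : realType) (P : probability T R) (a : R) : (\int[P]_t a%:E = a%:E)%E.
Proof. by rewrite -[RHS]mule1 -(probability_setT P) -integral_cst. Qed.

Lemma probability_integral_affine (d : measure_display)
  (T : measurableType d) (R : realType) (P : probability T R)
  (g : T -> \bar R) (a b : R) :
  measurable_fun setT g -> (forall w, 0 <= g w)%E -> 0 <= a -> 0 <= b ->
  (\int[P]_w (a%:E * g w + b%:E) = a%:E * \int[P]_w g w + b%:E)%E.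
Proof.
move=> mg g0 a0 b0; rewrite ge0_integralD//; last 2 first.
- by move=> w _; rewrite mule_ge0.
- exact: measurable_funeM.
by rewrite ge0_integralZl// probability_integral_cst.
Qed.

(** * Countably valued approximation of strongly measurable maps *)

Section strong_measurability.
Context (d : measure_display) (T : measurableType d) (R : realType).
Context (H : completeNormedModType R).

Lemma simple_vector_rel (s s' : T -> H) (A : H -> H -> Prop) :
  simple_vector s -> simple_vector s' -> measurable [set t | A (s t) (s' t)].
Proof.
move=> [fs ms] [fs' ms'].
have -> : [set t | A (s t) (s' t)] = \bigcup_(y in range s)
    \bigcup_(z in range s' `&` A y) (s @^-1` [set y] `&` s' @^-1` [set z]).
  apply/seteqP; split => [t /= At|t [y _ [z [_ Ayz] [/= -> ->]]]]//.
  by exists (s t); [exists t|exists (s' t); [split; [exists t|]|]].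
apply: fin_bigcup_measurable => // y _; apply: fin_bigcup_measurable.
  exact: finite_setIl.
by move=> z _; exact: measurableI.
Qed.

Lemma simple_vector_preimage (s : T -> H) (A : set H) :
  simple_vector s -> measurable (s @^-1` A).
Proof. by move=> ss; exact: (simple_vector_rel (fun y _ => A y) ss ss). Qed.

Context (mu : {measure set T -> \bar R}) (X : T -> H) (s_ : nat -> T -> H).
Hypothesis simple_s : forall n, simple_vector (s_ n).
Hypothesis cvg_s : {ae mu, forall t, s_ n t @[n --> \oo] --> X t}.

(** At almost every point the sequence is a Cauchy sequence, so some [s_ n]
    stays within [eta] of all its successors, hence of the limit; one selects
    measurably an [n] and the value of [s_ n] there. The pairs are encoded as
    natural numbers. *)
Lemma countably_valued_approximation (eta : R) : 0 < eta ->
  exists (M : T -> nat) (c : nat -> H),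
    (forall n, measurable (M @^-1` [set n])) /\
    {ae mu, forall t, `|X t - c (M t)| <= eta}.
Proof.
move=> eta0.
have /choice[r rE] n : exists r : seq H, range (s_ n) = [set` r].
  by have [/finite_seqP] := simple_s n.
pose stable n := [set t | forall m, (n <= m)%N -> `|s_ m t - s_ n t| <= eta].
pose value (k : nat) :=
  let: (n, j) := odflt (0, 0)%N (choice.unpickle k) in nth 0 (r n) j.
pose block (k : nat) := let: (n, j) := odflt (0, 0)%N (choice.unpickle k) in
  stable n `&` s_ n @^-1` [set nth 0 (r n) j].
have mstable n : measurable (stable n).
  have -> : stable n =
      \bigcap_(m in [set m | (n <= m)%N]) [set t | `|s_ m t - s_ n t| <= eta].
    by [].
  apply: bigcap_measurable; first by exists n => /=.
  by move=> m _; exact: (simple_vector_rel (fun y z => `|y - z| <= eta)).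
have mblock k : measurable (block k).
  rewrite /block; case: (odflt _ _) => n j.
  by apply: measurableI => //; exact: simple_vector_preimage.
(* the null set where nothing is selected is added to every block *)
pose bad := ~` \bigcup_k block k.
have mbad : measurable bad by exact/measurableC/bigcup_measurable.
have [|t|M [mM blockM]] := @measurable_selection _ T (fun k => block k `|` bad).
- by move=> k; exact: measurableU.
- have [[k _ kt]|nt] := pselect ((\bigcup_k block k) t).
    by exists k; left.
  by exists 0; right.
exists M, value; split => //.
have [N [mN N0 subN]] := cvg_s; exists N; split => // t /= Xt.
apply: subN => /= cvgt; apply: Xt; have [Bt|] := blockM t; last first.
  case.
  have : exists n, stable n t.
    have /cvgrPdist_le/(_ _ (divr_gt0 eta0 (ltr0Sn R 1)))[n _ close] := cvgt.
    exists n => m nm; rewrite (splitr eta) -(subrKA (X t)).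
    apply: le_trans (ler_normD _ _) _.
    rewrite lerD//; last exact: (close n (leqnn n)).
    by rewrite distrC; exact: close.
  move=> [n nt]; have : range (s_ n) (s_ n t) by exists t.
  rewrite rE/= => st.
  exists (choice.pickle (n, index (s_ n t) (r n))) => //.
  by rewrite /block choice.pickleK/=; split => //=; rewrite nth_index.
move: Bt; rewrite /block /value; case: (odflt _ _) => n j [nt /= <-].
apply/ler_addgt0Pl => e e0.
have /cvgrPdist_le/(_ _ e0)[m _ close] := cvgt.
rewrite -(subrKA (s_ (maxn m n) t)) (le_trans (ler_normD _ _))// lerD//.
  by apply: close => /=; exact: leq_maxl.
exact: (nt _ (leq_maxr m n)).
Qed.

(** [X] itself is only an almost everywhere limit of measurable maps; the
    limit superior of the squared norms is measurable and agrees with the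
    squared norm of [X] off the null set. *)
Lemma measurable_sqnorm_version : exists U : T -> \bar R,
  [/\ measurable_fun setT U, forall t, (0 <= U t)%E &
      {ae mu, forall t, U t = (`|X t| ^+ 2)%:E}].
Proof.
exists (fun t => limn_esup (fun n => (`|s_ n t| ^+ 2)%:E)); split.
- apply: measurable_fun_limn_esup => n mD A mA; apply: measurableI => //.
  exact: (simple_vector_preimage ((fun y => (`|y| ^+ 2)%:E) @^-1` A)).
- move=> t; rewrite limn_esup_lim; apply: lime_ge; first exact: is_cvg_esups.
  apply: nearW => n; apply: (@le_trans _ _ (`|s_ n t| ^+ 2)%:E).
    by rewrite lee_fin sqr_ge0.
  by apply: ereal_sup_ubound; exists n => /=.
- have [N [mN N0 subN]] := cvg_s; exists N; split => // t /= Xt.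
  apply: subN => /= cvgt; apply: Xt; apply: (cvg_limn_einf_sup _).2.
  apply: cvg_EFin; first exact: nearW.
  by apply: cvgM; exact: cvg_norm.
Qed.

End strong_measurability.

(** * Events independent of the draws to come *)

Section independence.
Context (dO dI : measure_display) (Omega : measurableType dO).
Context (I : measurableType dI) (R : realType) (P : probability Omega R).
Context (X : nat -> {RV P >-> I}).

(** Independence of the future draws is phrased on finite products, so that
    conditioning on one more draw is a matter of adding one factor; the event
    need not be described in terms of the past draws. *)
Definition independent_of_tail (k : nat) (B : set Omega) :=
  measurable B /\
  forall (J : {fset nat}) (A : nat -> set I),
    (forall j, j \in J -> (k <= j)%N) ->
    (forall j, j \in J -> measurable (A j)) ->
    P (B `&` \bigcap_(j in [set` J]) (X j @^-1` A j)) =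
      (P B * \prod_(j <- J) P (X j @^-1` A j))%E.

Lemma independent_of_tail_setT : mutually_independent X ->
  independent_of_tail 0 setT.
Proof.
move=> indX; split => // J A _ mA.
by rewrite setTI indX// probability_setT mul1e.
Qed.

Lemma independent_of_tail_set0 k : independent_of_tail k set0.
Proof. by split => // J A _ _; rewrite set0I measure0 mul0e. Qed.

Lemma measurable_rv_preimage k (A : set I) : measurable A ->
  measurable (X k @^-1` A).
Proof. by move=> mA; exact: measurable_funPTI. Qed.

Lemma independent_of_tail_head k B A :
  independent_of_tail k B -> measurable A ->
  P (B `&` X k @^-1` A) = (P B * P (X k @^-1` A))%E.
Proof.
move=> [mB indB] mA; have := indB [fset k]%fset (fun=> A).
rewrite big_seq_fset1.
have -> : \bigcap_(j in [set` [fset k]%fset]) X j @^-1` A = X k @^-1` A.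
  by rewrite set_fset1 bigcap_set1.
by apply => // j; rewrite inE => /eqP ->.
Qed.

(** Apply the product rule at [k] to the finite set of indices enlarged by [k],
    with [A] as the event of the [k]-th draw. *)
Lemma independent_of_tailI k B A : independent_of_tail k B -> measurable A ->
  independent_of_tail k.+1 (B `&` X k @^-1` A).
Proof.
move=> tB mA; split.
  by apply: measurableI; [exact: tB.1|exact: measurable_rv_preimage].
move=> J A' kJ mA'; rewrite (independent_of_tail_head tB mA).
have kJF : k \notin J by apply/negP => /kJ; rewrite ltnn.
have A'j j : j \in J -> (if j == k then A else A' j) = A' j.
  by move=> jJ; case: eqP => // jk; rewrite -jk jJ in kJF.
pose A1 j := if j == k then A else A' j.
have tailA1 := tB.2 (k |` J)%fset A1.
have A1k : A1 k = A by rewrite /A1 eqxx.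
rewrite big_fsetU1//= A1k muleA in tailA1.
have -> : (\prod_(j <- J) P (X j @^-1` A' j) =
    \prod_(j <- J) P (X j @^-1` A1 j))%E.
  by apply: eq_big_seq => j jJ; rewrite /A1 A'j.
rewrite -tailA1; last 2 first.
- by move=> j; rewrite !inE => /orP[/eqP->//|/kJ/ltnW].
- move=> j; rewrite !inE /A1.
  by case: eqP => [_ _|_ /= jJ]; [exact: mA|exact: mA'].
congr (P _); rewrite -setIA; congr (_ `&` _).
apply/seteqP; split => [w [Aw A'w] j /=|w A1w].
  rewrite !inE => /orP[/eqP ->|jJ]; first by rewrite A1k.
  by rewrite /A1 A'j//; exact: A'w.
split; first by have := A1w k; rewrite /= A1k; apply; rewrite !inE eqxx.
move=> j /= jJ; have := A1w j; rewrite /= /A1 A'j//; apply.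
by rewrite !inE jJ orbT.
Qed.

Section next_label.
Context (D : probability I R) (k : nat).
Hypothesis X_D : forall A, measurable A -> P (X k @^-1` A) = D A.

Lemma ae_rv_preimage (Q : I -> Prop) :
  {ae D, forall i, Q i} -> {ae P, forall w, Q (X k w)}.
Proof.
move=> [A [mA A0 subA]]; exists (X k @^-1` A); split.
- exact: measurable_rv_preimage.
- by rewrite [LHS]X_D.
- by move=> w /= nQ; exact: subA.
Qed.

Context (N : Omega -> nat) (M : nat -> I -> nat).
Hypothesis tailN : forall n, independent_of_tail k (N @^-1` [set n]).
Hypothesis mM : forall a b, measurable (M a @^-1` [set b]).

(** Keeping the previous label inside the new one makes each level set the
    intersection of a past event with an event of the current draw. *)
Definition next_label (w : Omega) : nat :=
  choice.pickle (N w, M (N w) (X k w)).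

Lemma next_label_tail n : independent_of_tail k.+1 (next_label @^-1` [set n]).
Proof.
have [[[a b] abn]|nex] := pselect (exists p : nat * nat, choice.pickle p = n).
  have -> : next_label @^-1` [set n] =
      N @^-1` [set a] `&` X k @^-1` (M a @^-1` [set b]).
    apply/seteqP; split => w /=; rewrite /next_label -abn.
      by move=> /(pcan_inj choice.pickleK)[-> ->].
    by move=> [-> ->].
  exact: independent_of_tailI.
rewrite (_ : _ @^-1` _ = set0); first exact: independent_of_tail_set0.
by rewrite -subset0 => w /= wn; apply: nex; eexists; exact: wn.
Qed.

(** The Markov property for labels: since the level sets of [N] are
    independent of the [k]-th draw, that draw can be integrated out first. *)
Lemma integral_next_label (h : nat -> nat -> \bar R) :
  (forall a b, 0 <= h a b)%E ->
  (\int[P]_w h (N w) (M (N w) (X k w)) =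
   \sum_(a <oo) P (N @^-1` [set a]) * \int[D]_i h a (M a i))%E.
Proof.
move=> h0.
have mN n : measurable (N @^-1` [set n]) := (tailN n).1.
have NT : \bigcup_n (N @^-1` [set n]) = setT.
  by apply/seteqP; split => // w _; exists (N w).
pose h' n := let: (a, b) := odflt (0, 0)%N (choice.unpickle n) in h a b.
have hE w : h (N w) (M (N w) (X k w)) = h' (next_label w).
  by rewrite /h' /next_label choice.pickleK.
rewrite -[X in integral _ X _]NT ge0_integral_bigcup//; last 2 first.
- rewrite (funext hE).
  apply: measurable_fun_label => n; exact: (next_label_tail n).1.
- by move=> m n _ _ [w [/= -> ->]].
apply: eq_eseriesr => a _.
under eq_integral.
  move=> w; rewrite inE/= => ->; over.
rewrite (@ge0_integral_label _ _ _ P (fun w => M a (X k w)))//; last first.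
  by move=> b; exact: (measurable_rv_preimage k (mM a b)).
rewrite (@ge0_integral_label _ _ _ D (M a) (mM a))//.
rewrite -[P _]fineK ?fin_num_measure// -nneseriesZl; last first.
  by move=> b _; rewrite mule_ge0.
apply: eq_eseriesr => b _; rewrite setTI fineK ?fin_num_measure//.
have := independent_of_tail_head (tailN a) (mM a b).
rewrite X_D// => PE; rewrite [X in (_ * X = _)%E]PE.
by rewrite muleCA.
Qed.
End next_label.
End independence.

(** * Absorbing a tolerance *)

(** The cross term [2 b eta] is at most [eta (b ^ 2 + 1)]. *)
Lemma sqr_close_le (R : realFieldType) (a b eta : R) :
  0 <= a -> 0 <= b -> 0 < eta ->
  a <= b + eta -> a ^+ 2 <= (1 + eta) * (b ^+ 2 + eta).
Proof.
move=> a0 b0 eta0 ab; have abeta : 0 <= b + eta by rewrite addr_ge0// ltW.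
have : a ^+ 2 <= (b + eta) ^+ 2 by rewrite ler_sqr.
have := mulr_ge0 (ltW eta0) (sqr_ge0 (b - 1)); lra.
Qed.

Lemma exists_small_tolerance (R : realFieldType) (B e : R) :
  0 <= B -> 0 < e -> exists eta : R,
  [/\ 0 < eta, 3 * eta <= e & (1 + eta) * (B + 2 * eta) <= B + e].
Proof.
move=> B0 e0; have B4 : 0 < B + 4 by rewrite ltr_wpDl.
(* eta <= 1 gives (1 + eta) (B + 2 eta) <= B + eta (B + 4) *)
exists (Num.min 1 (e / (B + 4))).
set eta := Num.min _ _.
have eta1 : eta <= 1 by rewrite ge_min lexx.
have etae : eta * (B + 4) <= e by rewrite -ler_pdivlMr// ge_min lexx orbT.
have eta0 : 0 < eta by rewrite lt_min ltr01 divr_gt0.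
have etaB := mulr_ge0 (ltW eta0) B0.
have : eta * eta <= eta * 1 by rewrite ler_pM2l.
by split => //; lra.
Qed.

(** * The mean of one step and the recursion *)

Section stochastic_gradient.
Context (R : realType) (H : completeNormedModType R).
Context (dot : {dot H for @idfun R}).
Hypothesis Hdot : induces_norm dot.
Context (dI : measure_display) (I : measurableType dI) (D : probability I R).
Context (f : I -> H -> R) (gradf : I -> H -> H) (L : I -> R) (supL : R).
Context (F : H -> R) (gradF : H -> H).
Hypothesis f_convex : forall i, convex_function [set: convex_lmodType H] (f i).
Hypothesis f_grad : forall i, is_gradient dot (f i) (gradf i).
Hypothesis f_lip : forall i, gradient_lipschitz (gradf i) (L i).
Hypothesis L_supL : {ae D, forall i, L i <= supL}.
Hypothesis f_int : forall x, D.-integrable [set: I] (fun i => (f i x)%:E).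
Hypothesis FE : forall x, (F x)%:E = ('E_D[fun i => f i x])%E.
Hypothesis F_grad : is_gradient dot F gradF.

Let gradient_lipschitz_supL :
  {ae D, forall i, gradient_lipschitz (gradf i) supL}.
Proof.
apply: filterS L_supL => i Li x y; rewrite (le_trans (f_lip i x y))//.
exact: ler_wpM2r.
Qed.

(** The difference quotients of the [f i] have as mean those of [F]. By
    convexity and the descent inequality they lie within a constant of their
    limit, so dominated convergence passes to the limit; being everywhere a
    limit of measurable functions, the inner product is measurable and not
    only almost everywhere equal to a measurable function. *)
Lemma gradient_mean y v :
  D.-integrable [set: I] (fun i => (dot (gradf i y) v)%:E) /\
  (\int[D]_i (dot (gradf i y) v)%:E = (dot (gradF y) v)%:E)%E.
Proof.
pose quot n i := n.+1%:R * (f i (y + n.+1%:R^-1 *: v) - f i y).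
have quot_cvg i : quot n i @[n --> \oo] --> dot (gradf i y) v.
  exact: gradient_quotient_cvg.
have quot_int n : D.-integrable [set: I] (EFin \o quot n).
  rewrite (_ : _ \o _ = fun i => n.+1%:R%:E *
    ((f i (y + n.+1%:R^-1 *: v))%:E - (f i y)%:E))%E; last by [].
  by apply: integrableZl => //; exact: integrableB.
have quotE n : (\int[D]_i (quot n i)%:E =
    (n.+1%:R * (F (y + n.+1%:R^-1 *: v) - F y))%:E)%E.
  rewrite EFinM EFinB !FE unlock -integralB// -integralZl//.
  exact: integrableB.
pose C := `|supL| * `|v| ^+ 2.
have quot_bound : {ae D, forall i n,
    dot (gradf i y) v <= quot n i <= dot (gradf i y) v + C}.
  apply: filterS gradient_lipschitz_supL => i lip n.
  pose e : R := n.+1%:R^-1.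
  have n0 : 0 < n.+1%:R :> R by [].
  have e0 : 0 < e by rewrite invr_gt0.
  have e1 : e <= 1 by rewrite invf_le1// ler1n.
  have ne : n.+1%:R * e = 1 by rewrite divff.
  have := convex_gradient_le (f_convex i) (f_grad i) y (e *: v).
  have := gradient_descent_le Hdot (f_grad i) lip y (e *: v).
  rewrite linearZr_LR/= normrZ gtr0_norm// exprMn /quot -/e => hi lo.
  have {}lo : e * dot (gradf i y) v <= f i (y + e *: v) - f i y by lra.
  apply/andP; split; first by rewrite -(ler_pM2l n0) mulrA ne mul1r in lo.
  have {}hi : f i (y + e *: v) - f i y <=
      e * (dot (gradf i y) v + supL / 2 * e * `|v| ^+ 2) by lra.
  rewrite -(ler_pM2l n0) mulrA ne mul1r in hi; apply: (le_trans hi).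
  rewrite lerD2l /C ler_wpM2r ?sqr_ge0//.
  have := ler_norm supL; have := normr_ge0 supL; nra.
have meas : measurable_fun setT (fun i => (dot (gradf i y) v)%:E).
  apply: (emeasurable_fun_cvg (fun n => EFin \o quot n)).
    by move=> n; exact: (measurable_int D).
  move=> i _; apply: cvg_EFin; first exact: nearW.
  exact: quot_cvg.
have [|||||int_dot _ cvg_int] := @dominated_convergence _ _ _ D setT measurableT
  (fun n => EFin \o quot n) (fun i => (dot (gradf i y) v)%:E)
  (fun i => (`|quot 0 i| + C)%:E).
- by move=> n; exact: (measurable_int D).
- exact: meas.
- apply: aeW => i _; apply: cvg_EFin; first exact: nearW.
  exact: quot_cvg.
- under eq_fun do rewrite EFinD.
  apply: integrableD => //; first exact: (integrable_abse (quot_int 0)).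
  exact: finite_measure_integrable_cst.
- apply: filterS quot_bound => i bnd n _.
  have /andP[l0 h0] := bnd 0; have /andP[ln hn] := bnd n.
  rewrite /= lee_fin.
  rewrite -lerBlDl (le_trans (lerB_dist _ _))// ler_norml.
  by lra.
split => //.
rewrite -(cvg_lim _ cvg_int)//; apply/cvg_lim => //=.
under eq_fun do rewrite quotE.
apply: cvg_EFin; first exact: nearW.
exact: gradient_quotient_cvg.
Qed.

Lemma gradient_mean_smooth x y :
  dot (gradF x - gradF y) (x - y) <= supL * `|x - y| ^+ 2.
Proof.
set v := x - y.
have [intx Ex] := gradient_mean x v; have [inty Ey] := gradient_mean y v.
rewrite linearBl/= -lee_fin EFinB -Ex -Ey -integralB//.
rewrite -[leRHS](probability_integral_cst D).
have intxy := integrableB measurableT intx inty.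
apply: ae_le_integral; [exact: (measurable_int D intxy)|by []|].
apply: filterS gradient_lipschitz_supL => i lip /=.
rewrite lee_fin -linearBl (le_trans (dot_le Hdot _ _))//.
by rewrite expr2 mulrA ler_wpM2r.
Qed.

(** The squared norm of the noise at the minimum is measurable only up to a
    null set, hence the version [U]. *)
Context (mu : R) (xstar : H) (gamma : R) (U : I -> \bar R) (s : R).
Hypothesis F_convex : gradient_strongly_convex dot gradF mu.
Hypothesis xstar_min : forall x, F xstar <= F x.
Hypothesis gamma_gt0 : 0 < gamma.
Hypothesis gamma_supL : gamma * supL < 1.
Hypothesis mU : measurable_fun setT U.
Hypothesis U_ge0 : forall i, (0 <= U i)%E.
Hypothesis U_grad : {ae D, forall i, U i = (`|gradf i xstar| ^+ 2)%:E}.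
Hypothesis U_s : (\int[D]_i U i <= s%:E)%E.

Let q := 1 - 2 * gamma * mu * (1 - gamma * supL).

(** One step from a fixed point, up to the tolerance [eta]. The deterministic
    bound on a step is integrated over the draw: its inner products become
    [dot (gradF y) (y - xstar)], to which strong convexity applies, and
    [dot (gradF xstar) (y - xstar)], which vanishes. The step is replaced by an
    approximation [c (M i)] with countably many values because the squared
    distance of the step itself is only almost everywhere equal to a
    measurable function. *)
Lemma integral_step_le (y : H) (eta : R) (M : I -> nat) (c : nat -> H) :
  0 < eta -> (forall n, measurable (M @^-1` [set n])) ->
  {ae D, forall i, `|y - gamma *: gradf i y - c (M i)| <= eta} ->
  (\int[D]_i (`|c (M i) - xstar| ^+ 2)%:E <=
   ((1 + eta) * (q * `|y - xstar| ^+ 2 + 2 * gamma ^+ 2 * s + eta))%:E)%E.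
Proof.
move=> eta0 mM Mclose; set u := y - xstar.
have [inty Ey] := gradient_mean y u; have [ints Es] := gradient_mean xstar u.
have gradF0 : gradF xstar = 0.
  exact: (gradient_at_min_eq0 Hdot F_grad xstar_min).
have intU : D.-integrable setT U.
  apply/integrableP; split => //.
  under eq_integral do rewrite gee0_abs//.
  by rewrite (le_lt_trans U_s) ?ltry.
pose l i := (1 + eta) * (`|u| ^+ 2 + eta) + (1 + eta) *
  (- (2 * gamma * (1 - gamma * supL)) * dot (gradf i y) u
   + - (2 * gamma ^+ 2 * supL) * dot (gradf i xstar) u).
have int_l : D.-integrable setT (EFin \o l) /\ (\int[D]_i (l i)%:E =
   ((1 + eta) * (`|u| ^+ 2 + eta) + (1 + eta) *
    (- (2 * gamma * (1 - gamma * supL)) * dot (gradF y) u))%:E)%E.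
  have lE : (fun i => (l i)%:E) = (fun i =>
      ((1 + eta) * (`|u| ^+ 2 + eta))%:E + (1 + eta)%:E *
      ((- (2 * gamma * (1 - gamma * supL)))%:E * (dot (gradf i y) u)%:E
       + (- (2 * gamma ^+ 2 * supL))%:E * (dot (gradf i xstar) u)%:E))%E by [].
  have intk1 :=
    integrableZl measurableT (- (2 * gamma * (1 - gamma * supL))) inty.
  have intk2 := integrableZl measurableT (- (2 * gamma ^+ 2 * supL)) ints.
  have int12 := integrableD measurableT intk1 intk2.
  have intk := integrableZl measurableT (1 + eta) int12.
  have intc := finite_measure_integrable_cst D
    ((1 + eta) * (`|u| ^+ 2 + eta)) measurableT.
  split; first by rewrite /comp lE; exact: integrableD.
  rewrite lE integralD// integralZl// integralD// !integralZl// Ey Es gradF0.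
  rewrite probability_integral_cst linear0l mule0 adde0.
  by rewrite -!EFinM -EFinD.
have [intl El] := int_l.
pose k := (1 + eta) * (2 * gamma ^+ 2).
have intkU : D.-integrable setT (fun i => k%:E * U i)%E by exact: integrableZl.
apply: (@le_trans _ _ (\int[D]_i ((l i)%:E + k%:E * U i))%E); last first.
  rewrite integralD// El integralZl//.
  have Ufin : (\int[D]_i U i)%E \is a fin_num by exact: integrable_fin_num.
  move: U_s; rewrite -(fineK Ufin); set r := fine _.
  rewrite -EFinM -EFinD !lee_fin => rs.
  have := F_convex y xstar; rewrite gradF0 subr0 dotC -/u => Fu.
  have uE : 2 * gamma * (1 - gamma * supL) * (mu * `|u| ^+ 2) <=
      2 * gamma * (1 - gamma * supL) * dot (gradF y) u.
    rewrite ler_wpM2l// !mulr_ge0 ?subr_ge0 ?(ltW gamma_gt0)//.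
    exact: ltW.
  have rsE : 2 * gamma ^+ 2 * r <= 2 * gamma ^+ 2 * s.
    by rewrite ler_wpM2l// mulr_ge0 ?sqr_ge0.
  rewrite /k -mulrDr -[X in _ + X <= _]mulrA -mulrDr ler_pM2l ?addr_gt0//.
  by rewrite /q; lra.
have intW : D.-integrable setT (fun i => (l i)%:E + k%:E * U i)%E.
  exact: integrableD.
have mW := measurable_int D intW.
have ml : measurable_fun setT (fun i => (`|c (M i) - xstar| ^+ 2)%:E).
  exact: (measurable_fun_label mM (fun n => (`|c n - xstar| ^+ 2)%:E)).
apply: ae_le_integral => //.
apply: filterS3 gradient_lipschitz_supL U_grad Mclose => i lip -> Mi.
rewrite /l /k -EFinM -EFinD lee_fin.
pose dist := `|y - gamma *: gradf i y - xstar|.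
apply: le_trans (@sqr_close_le _ _ dist _ (normr_ge0 _) (normr_ge0 _) eta0 _) _.
  rewrite -(subrKA (y - gamma *: gradf i y)) addrC.
  rewrite (le_trans (ler_normD _ _))// lerD2l distrC.
  exact: Mi.
have := gradient_step_sqdist_le Hdot lip gamma_gt0 y xstar
  (f_convex i) (f_grad i); rewrite -/u -/dist => hi.
rewrite -mulrDr -[X in _ <= _ + X]mulrA -mulrDr ler_pM2l ?addr_gt0//.
by lra.
Qed.

Hypothesis f_unbiased : forall x, bochner_mean D (fun i => gradf i x) (gradF x).

Lemma step_approximation y (eta : R) : 0 < eta ->
  exists (M : I -> nat) (c : nat -> H),
    (forall n, measurable (M @^-1` [set n])) /\
    {ae D, forall i, `|y - gamma *: gradf i y - c (M i)| <= eta}.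
Proof.
move=> eta0; have [s_ [simple_s cvg_s _ _]] := f_unbiased y.
have etag0 : 0 < eta / gamma by rewrite divr_gt0.
have [M [c [mM Mc]]] := countably_valued_approximation simple_s cvg_s etag0.
exists M, (fun n => y - gamma *: c n); split => //.
apply: filterS Mc => i Mi.
rewrite opprB addrC subrKA -scalerBr normrZ gtr0_norm// distrC.
by rewrite mulrC -ler_pdivlMr.
Qed.

Context (x0 : H) (dO : measure_display) (Omega : measurableType dO).
Context (P : probability Omega R) (i_ : nat -> {RV P >-> I}).
Hypothesis i_iid : iid D i_.
Hypothesis mu_gt0 : 0 < mu.
Hypothesis q_ge0 : 0 <= q.
Hypothesis s_ge0 : 0 <= s.

Let x_ k w := sgd gradf gamma x0 (fun j => i_ j w) k.
Let bound k :=
  q ^+ k * `|x0 - xstar| ^+ 2 + gamma / (mu * (1 - gamma * supL)) * s.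

(** The constant term is the fixed point of the one-step recursion. *)
Let boundS k : bound k.+1 = q * bound k + 2 * gamma ^+ 2 * s.
Proof.
have : 1 - gamma * supL != 0 by rewrite subr_eq0 eq_sym lt_eqF.
move=> g1; have mu0 := lt0r_neq0 mu_gt0.
by rewrite /bound exprS /q; field; rewrite mu0 g1.
Qed.

Let excess_ge0 : 0 <= gamma / (mu * (1 - gamma * supL)) * s.
Proof.
rewrite mulr_ge0// divr_ge0 ?(ltW gamma_gt0)// mulr_ge0 ?(ltW mu_gt0)//.
by rewrite subr_ge0 ltW.
Qed.

Let bound_ge0 k : 0 <= bound k.
Proof. by rewrite addr_ge0// mulr_ge0 ?exprn_ge0 ?sqr_ge0. Qed.

Let q_le1 : q <= 1.
Proof.
rewrite /q gerBl !mulr_ge0 ?(ltW gamma_gt0) ?(ltW mu_gt0)//.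
by rewrite subr_ge0 ltW.
Qed.

(** The expectation is controlled along countably valued approximations of the
    iterate, uniform up to a null set, whose level sets are independent of the
    draws to come. Given one for the [k]-th iterate, each of its values makes
    a step, this step is approximated in turn, and the new label records both
    choices; since a step is Lipschitz, the uniform error at most triples. The
    new squared distance is integrated first over the [k]-th draw, value by
    value. *)
Lemma sgd_approximation k (eta : R) : 0 < eta ->
  exists (N : Omega -> nat) (c : nat -> H),
    [/\ forall n, independent_of_tail i_ k (N @^-1` [set n]),
        {ae P, forall w, `|x_ k w - c (N w)| <= eta} &
        (\int[P]_w (`|c (N w) - xstar| ^+ 2)%:E <= (bound k + eta)%:E)%E].
Proof.
elim: k eta => [|k IH] eta eta0.
  exists (fun=> 0), (fun=> x0); split.
  - move=> n; have [<-|n0] := eqVneq 0 n.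
      rewrite preimage_cst; case: ifPn; last by rewrite in_set1 eqxx.
      by move=> _; apply: independent_of_tail_setT; exact: i_iid.2.
    rewrite preimage_cst; case: ifPn => [|_]; last first.
      exact: independent_of_tail_set0.
    by rewrite inE/= => n0'; rewrite n0' eqxx in n0.
  - by apply: aeW => w; rewrite /= subrr normr0 ltW.
  - rewrite probability_integral_cst lee_fin /bound expr0 mul1r.
    by have := excess_ge0; lra.
have [eta' [eta'0 eta'3 eta'B]] := exists_small_tolerance (bound_ge0 k.+1) eta0.
have [N [c [tailN Nc intN]]] := IH _ eta'0.
have /choice[M /choice[c' Mc']] a := step_approximation (c a) eta'0.
have mM a b : measurable (M a @^-1` [set b]) by exact: (Mc' a).1.
have X_D A : measurable A -> P (i_ k @^-1` A) = D A.
  by move=> mA; exact: (i_iid.1 k A mA).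
pose c1 n := let: (a, b) := odflt (0, 0)%N (choice.unpickle n) in c' a b.
exists (next_label i_ k N M), c1.
have c1E w : c1 (next_label i_ k N M w) = c' (N w) (M (N w) (i_ k w)).
  by rewrite /c1 /next_label choice.pickleK.
split.
- exact: next_label_tail.
- have step_close : {ae P, forall w, forall a,
      `|c a - gamma *: gradf (i_ k w) (c a) - c' a (M a (i_ k w))| <= eta'}.
    by apply: ae_foralln => a; exact: (ae_rv_preimage X_D (Mc' a).2).
  apply: filterS3 Nc step_close (ae_rv_preimage X_D gradient_lipschitz_supL).
  move=> w xc Tc lip; rewrite c1E /x_ /= -/(x_ k w).
  rewrite (le_trans _ eta'3)//.
  rewrite -(subrKA (c (N w) - gamma *: gradf (i_ k w) (c (N w)))).
  have Tlip :=
    gradient_step_lipschitz lip gamma_gt0 (x_ k w) (c (N w)) gamma_supL.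
  rewrite (le_trans (ler_normD _ _))//.
  have := Tc (N w); lra.
under eq_integral do rewrite c1E.
rewrite (@integral_next_label _ _ _ _ _ _ _ D k X_D N M tailN mM
  (fun a b => (`|c' a b - xstar| ^+ 2)%:E)); last first.
  by move=> a b; rewrite lee_fin sqr_ge0.
(* (1 + eta') C is the part of the one-step bound that does not depend on the
   iterate *)
pose C := 2 * gamma ^+ 2 * s + eta'.
have C0 : 0 <= C by rewrite addr_ge0 ?mulr_ge0 ?sqr_ge0// ltW.
have eta'1 : 0 <= 1 + eta' by rewrite addr_ge0// ltW.
pose psi a : \bar R := (((1 + eta') * q)%:E * (`|c a - xstar| ^+ 2)%:E
  + ((1 + eta') * C)%:E)%E.
apply: (@le_trans _ _ (\int[P]_w psi (N w))%E).
  have mN n : measurable (N @^-1` [set n]) := (tailN n).1.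
  rewrite (@ge0_integral_label _ _ _ P N mN setT psi measurableT); last first.
    by move=> a; rewrite /psi -EFinM -EFinD lee_fin addr_ge0 ?mulr_ge0 ?sqr_ge0.
  apply: lee_nneseries => [a _ _|a _].
    by rewrite mule_ge0// integral_ge0// => i _; rewrite lee_fin sqr_ge0.
  rewrite setTI muleC lee_wpmul2r//.
  rewrite /psi -EFinM -EFinD.
  rewrite (le_trans (integral_step_le eta'0 (mM a) (Mc' a).2))//.
  by rewrite lee_fin /C; lra.
have mcN : measurable_fun setT (fun w => (`|c (N w) - xstar| ^+ 2)%:E).
  exact: (measurable_fun_label (fun n => (tailN n).1)
    (fun n => (`|c n - xstar| ^+ 2)%:E)).
rewrite /psi probability_integral_affine ?mulr_ge0//.
apply: (@le_trans _ _
  (((1 + eta') * q)%:E * (bound k + eta')%:E + ((1 + eta') * C)%:E)%E).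
  by rewrite leeD2r// lee_wpmul2l// lee_fin mulr_ge0.
rewrite -EFinM -EFinD lee_fin (le_trans _ eta'B)// -mulrA -mulrDr ler_wpM2l//.
rewrite boundS /C; have := ler_wpM2r (ltW eta'0) q_le1; lra.
Qed.

Lemma sgd_sqdist_le k :
  ('E_P[fun w => (`|x_ k w - xstar| ^+ 2)%R] <= (bound k)%:E)%E.
Proof.
rewrite unlock; apply/lee_addgt0Pr => e e0.
have [eta [eta0 eta3 etaB]] := exists_small_tolerance (bound_ge0 k) e0.
have [N [c [tailN Nc intN]]] := sgd_approximation k eta0.
have eta1 : 0 <= 1 + eta by rewrite addr_ge0// ltW.
pose g w := (`|c (N w) - xstar| ^+ 2)%:E.
have g0 w : (0 <= g w)%E by rewrite lee_fin sqr_ge0.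
apply: (@le_trans _ _
  (\int[P]_w ((1 + eta)%:E * g w + ((1 + eta) * eta)%:E))%E).
  apply: ge0_ae_le_integral_nonmeasurable.
  - by move=> w; rewrite lee_fin sqr_ge0.
  - by move=> w; rewrite adde_ge0 ?mule_ge0 ?lee_fin ?mulr_ge0// ltW.
  apply: filterS Nc => w close.
  rewrite /g -EFinM -EFinD -mulrDr lee_fin sqr_close_le//.
  rewrite -(subrKA (c (N w))) addrC (le_trans (ler_normD _ _))//.
  by rewrite lerD2l.
rewrite probability_integral_affine//; last 2 first.
  exact: (measurable_fun_label (fun n => (tailN n).1)
    (fun n => (`|c n - xstar| ^+ 2)%:E)).
  by rewrite mulr_ge0// ltW.
apply: (@le_trans _ _
  ((1 + eta)%:E * (bound k + eta)%:E + ((1 + eta) * eta)%:E)%E).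
  by rewrite leeD2r// lee_wpmul2l.
rewrite -EFinM -!EFinD lee_fin (le_trans _ etaB)// -mulrDr ler_wpM2l//; lra.
Qed.

End stochastic_gradient.

(** * The convergence bound *)

Unset Implicit Arguments.

(* The bound is stated in the extended reals since sigma^2 may be infinite; the
   inverse of supL is the extended one, so that 1 / 0 = +oo. *)
Theorem theorem2p1 (R : realType)
  (H : completeNormedModType R) (dot : {dot H for @idfun R})
  (Hdot : induces_norm dot)
  (dI : measure_display) (I : measurableType dI) (D : probability I R)
  (f : I -> H -> R) (gradf : I -> H -> H) (L : I -> R) (supL : R)
  (F : H -> R) (gradF : H -> H) (mu : R) (xstar : H) (sigma2 : \bar R)
  (f_convex : forall i, convex_function [set: convex_lmodType H] (f i))
  (f_grad : forall i, is_gradient dot (f i) (gradf i))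
  (f_C1 : forall i, continuous (gradf i))
  (L_ge0 : forall i, 0 <= L i)
  (f_lip : forall i, gradient_lipschitz (gradf i) (L i))
  (supLE : supL%:E = ess_sup D (fun i => (L i)%:E))
  (f_int : forall x, D.-integrable [set: I] (fun i => (f i x)%:E))
  (FE : forall x, (F x)%:E = ('E_D[fun i => f i x])%E)
  (F_grad : is_gradient dot F gradF)
  (f_unbiased : forall x, bochner_mean D (fun i => gradf i x) (gradF x))
  (mu_gt0 : 0 < mu)
  (F_convex : gradient_strongly_convex dot gradF mu)
  (xstar_min : forall x, F xstar <= F x)
  (sigma2E : sigma2 = ('E_D[fun i => (`|gradf i xstar| ^+ 2)%R])%E)
  (gamma : R) (gamma_gt0 : 0 < gamma)
  (gamma_lt : (gamma%:E < (supL%:E)^-1)%E)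
  (x0 : H)
  (dO : measure_display) (Omega : measurableType dO) (P : probability Omega R)
  (i_ : nat -> {RV P >-> I}) (i_iid : iid D i_) (k : nat) :
  ('E_P[fun w => (`|sgd gradf gamma x0 (fun j => i_ j w) k - xstar| ^+ 2)%R]
   <= ((1 - 2 * gamma * mu * (1 - gamma * supL)) ^+ k
         * `|x0 - xstar| ^+ 2)%R%:E
      + (gamma / (mu * (1 - gamma * supL)))%R%:E * sigma2)%E.
Proof.
have L_supL : {ae D, forall i, L i <= supL}.
  have := ess_sup_ge D (fun i => (L i)%:E); rewrite -supLE.
  by apply: filterS => i; rewrite lee_fin.
have supL_ge0 : 0 <= supL.
  rewrite -lee_fin supLE; apply: ess_sup_gee; last exact: aeW.
  by rewrite [X in (_ < X)%E](probability_setT D).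
have gamma_supL : gamma * supL < 1.
  move: gamma_lt; have [->|supL0] := eqVneq supL 0; first by rewrite mulr0.
  have {}supL0 : 0 < supL by rewrite lt_neqAle eq_sym supL0.
  by rewrite inver gt_eqF// lte_fin -(ltr_pM2r supL0) mulVf ?gt_eqF.
have gL0 : 0 < 1 - gamma * supL by rewrite subr_gt0.
have K_gt0 : 0 < gamma / (mu * (1 - gamma * supL)).
  by rewrite divr_gt0// mulr_gt0.
have sigma2_ge0 : (0 <= sigma2)%E.
  by rewrite sigma2E unlock integral_ge0// => i _; rewrite lee_fin sqr_ge0.
have [sigma2y|sigma2_fin] := eqVneq sigma2 +oo%E.
  by rewrite sigma2y gt0_muley// addey// leey.
have {sigma2_fin}sigma2_fin : sigma2 \is a fin_num.
  by rewrite ge0_fin_numE// lt_neqAle sigma2_fin leey.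
pose s := fine sigma2.
have sE : sigma2 = s%:E by rewrite fineK.
have s_ge0 : 0 <= s by rewrite -lee_fin -sE.
have [s_ [simple_s cvg_s _ _]] := f_unbiased xstar.
have [U [mU U_ge0 U_grad]] := measurable_sqnorm_version simple_s cvg_s.
have U_s : (\int[D]_i U i <= s%:E)%E.
  rewrite -sE sigma2E unlock; apply: ge0_ae_le_integral_nonmeasurable => //.
  by apply: filterS U_grad => i ->.
have [q_ge0|q_lt0] := leP 0 (1 - 2 * gamma * mu * (1 - gamma * supL)).
  rewrite sE -EFinM -EFinD.
  exact: (sgd_sqdist_le Hdot f_convex f_grad f_lip L_supL f_int FE F_grad
    F_convex xstar_min gamma_gt0 gamma_supL mU U_ge0 U_grad U_s f_unbiased
    x0 i_iid mu_gt0 q_ge0 s_ge0 k).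
(* A negative factor makes its odd powers useless as bounds. It occurs only in
   the zero space: elsewhere mu <= supL, so that with t = gamma supL the factor
   is at least 1 - 2 t (1 - t) > 0. *)
have H_trivial x : x = xstar.
  apply/eqP; rewrite -subr_eq0 -normr_eq0 -sqrf_eq0.
  apply: contraTT q_lt0 => x0'.
  have {}x0' : 0 < `|x - xstar| ^+ 2 by rewrite lt_neqAle eq_sym x0' sqr_ge0.
  have mu_supL : mu <= supL.
    rewrite -(ler_pM2r x0'); apply: le_trans (F_convex x xstar) _.
    rewrite dotC.
    exact: (gradient_mean_smooth Hdot f_convex f_grad f_lip L_supL
      f_int FE F_grad).
  rewrite -leNgt.
  have : gamma * mu * (1 - gamma * supL) <= gamma * supL * (1 - gamma * supL).
    by rewrite ler_pM2r// ler_pM2l.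
  have := sqr_ge0 (1 - 2 * (gamma * supL)).
  set t := gamma * supL; lra.
rewrite (_ : 'E_P[_] = 0)%E.
  rewrite (H_trivial x0) subrr normr0 expr0n/= mulr0 add0e.
  by rewrite mule_ge0// lee_fin ltW.
rewrite unlock integral0_eq// => w _.
by rewrite (H_trivial (sgd _ _ _ _ _)) subrr normr0 expr0n.
Qed.
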